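(* The class $\mathbf{OBD}$ of all ordered Bratteli diagrams, with ordered morphisms (equivalence classes $[f]$ of ordered premorphisms) as arrows and with composition $[g][f]=[gf]$, is a category. Two ordered Bratteli diagrams are isomorphic in this category if and only if they are equivalent in the sense of Herman, Putnam, and Skau.
   Context: **Bratteli diagrams.** A Bratteli diagram $(V,E)$ consists of a vertex set $V=V_0\sqcup V_1\sqcup\cdots$ with each $V_n$ finite and non-empty and $V_0$ a singleton, and an edge set $E=E_1\sqcup E_2\sqcup\cdots$ with each $E_n$ finite and non-empty, together with maps $r,s:E\to V$ (range, source) such that $r(E_n)\subseteq V_n$, $s(E_n)\subseteq V_{n-1}$, $s^{-1}\{v\}\neq\varnothing$ for all $v\in V$ and $r^{-1}\{v\}\ne\varnothing$ for all $v\in V\setminus V_0$. An ordered Bratteli diagram $(V,E,\geq)$ is a Bratteli diagram with a partial order on $E$ such that $e,e'$ are comparable iff $r(e)=r(e')$ (so each $r^{-1}\{v\}$ is linearly ordered). **Edge sets.** An ordered edge set from a finite set $S$ to a finite set $T$ is a finite set $F$ with maps $s:F\to S$, $r:F\to T$ and a linear order on each $r^{-1}\{w\}$, $w\in T$. If $G$ is an ordered edge set from $T$ to $U$, then $F\circ G=\{(e,g)\in F\times G: r(e)=s(g)\}$, with source $s(e)$, range $r(g)$, and the induced (lexicographic) order: for $r(g)=r(g')$, $(e,g)<(e',g')$ iff $g<g'$, or $g=g'$ and $e<e'$. Write $F\cong F'$ if there is a (necessarily unique) bijection $F\to F'$ preserving sources, ranges and order. For $k<l$, $E_{k,l}=E_{k+1}\circ\cdots\circ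 E_l$ (paths from $V_k$ to $V_l$); $E_{k,k}$ consists of one edge from $v$ to $v$ for each $v\in V_k$. **Ordered premorphisms.** Let $B=(V,E,\geq)$, $C=(W,S,\geq)$ be ordered Bratteli diagrams. An ordered premorphism $f:B\to C$ is a triple $(F,(f_n)_{n\ge0},\geq)$ where $(f_n)$ is an unbounded sequence of integers with $0=f_0\le f_1\le f_2\le\cdots$, and $F=F_0\sqcup F_1\sqcup\cdots$ where each $F_n$ is a non-empty finite ordered edge set from $V_n$ to $W_{f_n}$ such that every $v\in V_n$ is the source and every $w\in W_{f_n}$ the range of some edge of $F_n$, $F_0$ is a singleton, and $E_{n+1}\circ F_{n+1}\cong F_n\circ S_{f_n,f_{n+1}}$ for all $n\ge0$. **Composition.** For $f=(F,(f_n),\ge):B\to C$ and $g=(G,(g_n),\ge):C\to D$, $gf=(H,(h_n),\ge)$ with $h_n=g_{f_n}$ and $H_n=F_n\circ G_{f_n}$. **Equivalence of premorphisms and morphisms.** Ordered premorphisms $f=(F,(f_n),\ge)$ and $g=(G,(g_n),\ge)$ from $B$ to $C$ are equivalent, $f\sim g$, if there are sequences of positive integers $(n_k)_{k\ge1},(m_k)_{k\ge1}$ with $n_k<m_k<n_{k+1}$ and $f_{n_k}<g_{m_k}<f_{n_{k+1}}$ such that for all $k\ge1$ $$E_{n_k,m_k}\circ G_{m_k}\cong F_{n_k}\circ S_{f_{n_k},g_{m_k}},\qquad E_{m_k,n_{k+1}}\circ F_{n_{k+1}}\cong G_{m_k}\circ S_{g_{m_k},f_{n_{k+1}}}.$$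 This is an equivalence relation; the class of $f$ is the ordered morphism $[f]:B\to C$. **Equivalence of Herman, Putnam, and Skau.** A telescoping of $(V,E,\ge)$ along $0=n_0<n_1<n_2<\cdots$ is the ordered Bratteli diagram with $k$-th vertex set $V_{n_k}$ and $k$-th edge set $E_{n_{k-1},n_k}$ with its induced order. Two ordered Bratteli diagrams are isomorphic in the sense of Herman, Putnam, and Skau if there are level-preserving bijections of vertices and of edges intertwining source and range maps and preserving the order. Equivalence in the sense of Herman, Putnam, and Skau is the equivalence relation on ordered Bratteli diagrams generated by this isomorphism and by telescoping. *)

(* Defs.v *)
From mathcomp Require Import all_boot.
From Stdlib Require Import Relations.Relation_Operators.

Set Implicit Arguments.
Unset Strict Implicit.
Unset Printing Implicit Defensive.

(* The linear orders on the fibres of [rng] are given together, as one partial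
   order for which two edges are comparable iff they have the same range. *)
Record oedges (S T : finType) := OEdges {
  oedge :> finType;
  src : oedge -> S;
  rng : oedge -> T;
  ole : rel oedge;
  ole_refl : reflexive ole;
  ole_anti : antisymmetric ole;
  ole_trans : transitive ole;
  ole_comparable : forall e e', ole e e' || ole e' e = (rng e == rng e') }.

Arguments src {S T o}.
Arguments rng {S T o}.
Arguments ole {S T o}.

Definition olt (S T : finType) (F : oedges S T) : rel F :=
  fun e e' => (e != e') && ole e e'.
Arguments olt {S T F}.

Definition oiso (S T : finType) (F G : oedges S T) : Prop :=
  exists f : F -> G,
    [/\ bijective f,
        forall e, src (f e) = src e,
        forall e, rng (f e) = rng e &
        forall e e', ole (f e) (f e') = ole e e'].

Section Composition.
Variables (S T U : finType) (F : oedges S T) (G : oedges T U).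

Definition ocomp_edge : finType := {p : F * G | rng p.1 == src p.2}.
Definition ocomp_src (p : ocomp_edge) : S := src (val p).1.
Definition ocomp_rng (p : ocomp_edge) : U := rng (val p).2.
Definition ocomp_le : rel ocomp_edge := fun p q =>
  olt (val p).2 (val q).2
  || ((val p).2 == (val q).2) && ole (val p).1 (val q).1.

Lemma ocomp_leE p q : ocomp_le p q =
  if (val p).2 == (val q).2 then ole (val p).1 (val q).1
  else ole (val p).2 (val q).2.
Proof. by rewrite /ocomp_le /olt; case: eqP => //= _; rewrite orbF. Qed.

Lemma ocomp_le_refl : reflexive ocomp_le.
Proof. by move=> p; rewrite ocomp_leE eqxx ole_refl. Qed.

Lemma ocomp_le_anti : antisymmetric ocomp_le.
Proof.
move=> p q; rewrite !ocomp_leE [(val q).2 == _]eq_sym.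
case: eqVneq => [e2 /ole_anti e1|/eqP ne /ole_anti //].
by apply: val_inj; case: (val p) (val q) e1 e2 => [? ?] [? ?] /= -> ->.
Qed.

Lemma ocomp_le_trans : transitive ocomp_le.
Proof.
move=> q p r; rewrite !ocomp_leE.
case: (eqVneq (val p).2 (val q).2) => [->|npq].
  by case: eqVneq => // _; apply: ole_trans.
case: (eqVneq (val q).2 (val r).2) => [<-|nqr]; first by rewrite (negPf npq).
case: (eqVneq (val p).2 (val r).2) => [e|_] le1 le2; last exact: ole_trans le2.
by case/eqP: nqr; apply: ole_anti; rewrite le2 -e le1.
Qed.

Lemma ocomp_le_comparable p q :
  ocomp_le p q || ocomp_le q p = (ocomp_rng p == ocomp_rng q).
Proof.
rewrite !ocomp_leE [(val q).2 == _]eq_sym /ocomp_rng.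
case: eqVneq => [e|_]; last exact: ole_comparable.
by rewrite ole_comparable (eqP (valP p)) (eqP (valP q)) e !eqxx.
Qed.

Definition ocomp : oedges S U :=
  @OEdges _ _ ocomp_edge ocomp_src ocomp_rng ocomp_le
    ocomp_le_refl ocomp_le_anti ocomp_le_trans ocomp_le_comparable.

End Composition.

Notation "F \oc G" := (ocomp F G) (at level 50, left associativity).

(* [oid V k l] is empty if [k != l]; [oid V k k] has exactly one edge, from [v]
   to [v], for each [v : V k]. Keeping [k] and [l] apart avoids casts in
   [opath] below. *)
Section Identity.
Variables (V : nat -> finType) (k l : nat).

Definition oid_edge : finType :=
  {p : V k * V l | Tagged V p.1 == Tagged V p.2}.

Lemma oid_comparable (p q : oid_edge) :
  (p == q) || (q == p) = ((val p).2 == (val q).2).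
Proof.
rewrite [q == p]eq_sym orbb; apply/eqP/eqP => [-> //|].
case: p q => [[a b] /= ab] [[c d] /= cd] bd; apply: val_inj => /=.
by move: ab; rewrite bd -(eqP cd) eq_Tagged /= => /eqP ->.
Qed.

Lemma oid_anti : antisymmetric (fun p q : oid_edge => p == q).
Proof. by move=> p q /andP[/eqP]. Qed.

Lemma oid_trans : transitive (fun p q : oid_edge => p == q).
Proof. by move=> p q r /eqP->. Qed.

Definition oid : oedges (V k) (V l) :=
  @OEdges _ _ oid_edge (fun p => (val p).1) (fun p => (val p).2)
    (fun p q => p == q) (@eqxx _) oid_anti oid_trans oid_comparable.

End Identity.

(* With [E n] the edge set from [V n] to [V n.+1], [opath E k l] is
   oid k k \oc E k \oc ... \oc E l.-1 if [k <= l] (the leading [oid V k k] is a unit for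
   [\oc] up to [oiso], see [ocomp1]), and is empty if [l < k]. *)
Fixpoint opath (V : nat -> finType) (E : forall n, oedges (V n) (V n.+1))
    (k l : nat) : oedges (V k) (V l) :=
  match l with
  | 0 => oid V k 0
  | l'.+1 => if k <= l' then opath E k l' \oc E l' else oid V k l'.+1
  end.

(* [edg n] is the edge set E_{n+1}, from V_n to V_{n+1}. *)
Record obd := OBDiagram {
  vtx : nat -> finType;
  edg : forall n, oedges (vtx n) (vtx n.+1);
  vtx_gt0 : forall n, 0 < #|vtx n|;
  vtx0 : #|vtx 0| = 1;
  edg_gt0 : forall n, 0 < #|edg n|;
  edg_src : forall n (v : vtx n), exists e : edg n, src e = v;
  edg_rng : forall n (v : vtx n.+1), exists e : edg n, rng e = v }.

Definition epath (B : obd) (k l : nat) : oedges (vtx B k) (vtx B l) :=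
  opath (edg B) k l.

Record opremor (B C : obd) := OPremor {
  lev : nat -> nat;
  pedg : forall n, oedges (vtx B n) (vtx C (lev n));
  lev0 : lev 0 = 0;
  lev_homo : forall n, lev n <= lev n.+1;
  lev_unbounded : forall N, exists n, N <= lev n;
  pedg_gt0 : forall n, 0 < #|pedg n|;
  pedg_src : forall n (v : vtx B n), exists e : pedg n, src e = v;
  pedg_rng : forall n (w : vtx C (lev n)), exists e : pedg n, rng e = w;
  pedg0 : #|pedg 0| = 1;
  pedg_comm : forall n,
    oiso (edg B n \oc pedg n.+1) (pedg n \oc epath C (lev n) (lev n.+1)) }.

Section IsoTheory.
Variables (S T U W : finType).

Lemma oiso_refl (F : oedges S T) : oiso F F.
Proof. by exists id; split=> //; exists id. Qed.

Lemma oiso_sym (F G : oedges S T) : oiso F G -> oiso G F.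
Proof.
case=> f [[g fK gK] fs fr fo]; exists g; split.
- by exists f.
- by move=> e; rewrite -fs gK.
- by move=> e; rewrite -fr gK.
- by move=> e e'; rewrite -fo !gK.
Qed.

Lemma oiso_trans (F G H : oedges S T) : oiso F G -> oiso G H -> oiso F H.
Proof.
case=> f [fb fs fr fo] [g [gb gs gr go]]; exists (g \o f); split.
- exact: bij_comp.
- by move=> e /=; rewrite gs fs.
- by move=> e /=; rewrite gr fr.
- by move=> e e' /=; rewrite go fo.
Qed.

Lemma ocomp_iso (F F' : oedges S T) (G G' : oedges T U) :
  oiso F F' -> oiso G G' -> oiso (F \oc G) (F' \oc G').
Proof.
case=> f [[f' fK f'K] fs fr fo] [g [[g' gK g'K] gs gr go]].
have f's e : src (f' e) = src e by rewrite -fs f'K.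
have f'r e : rng (f' e) = rng e by rewrite -fr f'K.
have g's e : src (g' e) = src e by rewrite -gs g'K.
have hP (p : F \oc G) : rng (f (val p).1) == src (g (val p).2).
  by rewrite fr gs (valP p).
have h'P (p : F' \oc G') : rng (f' (val p).1) == src (g' (val p).2).
  by rewrite f'r g's (valP p).
exists (fun p => exist _ (f (val p).1, g (val p).2) (hP p)); split.
- exists (fun p => exist _ (f' (val p).1, g' (val p).2) (h'P p)) => p;
    apply: val_inj; rewrite /= ?fK ?gK ?f'K ?g'K; by case: (val p).
- by move=> p; apply: fs.
- by move=> p; apply: gr.
- move=> p q; rewrite /= !ocomp_leE /= (can_eq gK); by case: eqP.
Qed.

Lemma ocompA (F : oedges S T) (G : oedges T U) (H : oedges U W) :
  oiso (F \oc G \oc H) (F \oc (G \oc H)).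
Proof.
pose A := (F \oc G \oc H : finType); pose B := (F \oc (G \oc H) : finType).
have h1 (p : A) : rng (val (val p).1).2 == src (val p).2 := valP p.
pose x (p : A) : G \oc H := exist _ ((val (val p).1).2, (val p).2) (h1 p).
have h2 (p : A) : rng (val (val p).1).1 == src (x p) := valP (val p).1.
have k1 (q : B) : rng (val q).1 == src (val (val q).2).1 := valP q.
pose y (q : B) : F \oc G := exist _ ((val q).1, (val (val q).2).1) (k1 q).
have k2 (q : B) : rng (y q) == src (val (val q).2).2 := valP (val q).2.
exists (fun p : A => exist _ ((val (val p).1).1, x p) (h2 p)); split=> //.
- exists (fun q : B => exist _ (y q, (val (val q).2).2) (k2 q)).
    case=> -[p h] /= hp; apply: val_inj => /=.
    by congr pair; apply: val_inj => /=; case: (val p).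
  case=> -[f p] /= hp; apply: val_inj => /=.
  by congr pair; apply: val_inj => /=; case: (val p).
- move=> p q; rewrite /= !ocomp_leE /= -val_eqE /= xpair_eqE !ocomp_leE /=.
  by case: (eqVneq (val p).2) => _; rewrite ?andbT ?andbF.
Qed.

End IsoTheory.

Section PathTheory.
Variable V : nat -> finType.

Lemma oidE k (p : oid V k k) : src p = rng p.
Proof.
by have := valP p; rewrite eq_Tagged /= => /eqP.
Qed.

Lemma oid1_subproof k (v : V k) : Tagged V v == Tagged V v.
Proof. exact: eqxx. Qed.

Definition oid1 k (v : V k) : oid V k k := exist _ (v, v) (oid1_subproof v).

Lemma oid1_rng k (p : oid V k k) : oid1 (rng p) = p.
Proof.
apply: val_inj => /=; have := oidE p; rewrite /=.
by case: (val p) => a b /= ->.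
Qed.

Lemma ocomp1 k (T : finType) (F : oedges (V k) T) : oiso (oid V k k \oc F) F.
Proof.
have hP (e : F) : rng (oid1 (src e)) == src e by [].
exists (fun p => (val p).2); split.
- exists (fun e => exist _ (oid1 (src e), e) (hP e)) => [|//].
  case=> -[a b] ab; have eab : rng a = src b := eqP ab; apply: val_inj => /=.
  by rewrite -eab oid1_rng.
- by move=> p; rewrite -(eqP (valP p)) -oidE.
- by [].
- move=> p q; rewrite /= ocomp_leE; case: eqVneq => // e.
  rewrite e ole_refl /= -[(val p).1]oid1_rng -[(val q).1]oid1_rng.
  by rewrite (eqP (valP p)) (eqP (valP q)) e eqxx.
Qed.

Lemma ocomp1r k (S : finType) (F : oedges S (V k)) : oiso (F \oc oid V k k) F.
Proof.
have hP (e : F) : rng e == src (oid1 (rng e)) by [].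
exists (fun p => (val p).1); split.
- exists (fun e => exist _ (e, oid1 (rng e)) (hP e)) => [|//].
  case=> -[a b] ab; have eab : rng a = src b := eqP ab; apply: val_inj => /=.
  by rewrite eab oidE oid1_rng.
- by [].
- by move=> p; rewrite (eqP (valP p)) oidE.
- move=> p q; rewrite /= ocomp_leE; case: eqVneq => // ne.
  rewrite [LHS](_ : _ = false); last first.
    apply/negP => le_pq; have := ole_comparable (val p).1 (val q).1.
    rewrite le_pq (eqP (valP p)) (eqP (valP q)) !oidE => /esym/eqP e.
    by case/eqP: ne; rewrite -[(val p).2]oid1_rng e oid1_rng.
  by rewrite /= (negPf ne).
Qed.

Variable E : forall n, oedges (V n) (V n.+1).

Lemma opathkk k : opath E k k = oid V k k.
Proof. by case: k => //= k; rewrite ltnn. Qed.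

Lemma opathS k l : k <= l -> opath E k l.+1 = opath E k l \oc E l.
Proof. by move=> /= ->. Qed.

Lemma opath_cat k l m : k <= l <= m ->
  oiso (opath E k m) (opath E k l \oc opath E l m).
Proof.
case/andP=> kl; elim: m => [|m IHm].
  by rewrite leqn0 => /eqP ?; subst l; rewrite opathkk; apply/oiso_sym/ocomp1r.
rewrite leq_eqVlt => /predU1P[?|lm].
  by subst l; rewrite [opath E m.+1 _]opathkk; apply/oiso_sym/ocomp1r.
rewrite ltnS in lm; rewrite !opathS ?(leq_trans kl) //.
apply: oiso_trans (ocompA _ _ _).
exact: ocomp_iso (IHm lm) (oiso_refl _).
Qed.

Lemma opath_src : (forall n (v : V n), exists e : E n, src e = v) ->
  forall k l, k <= l -> forall v : V k, exists e : opath E k l, src e = v.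
Proof.
move=> Es k; elim=> [|l IHl].
  by rewrite leqn0 => /eqP-> v; exists (oid1 v).
rewrite leq_eqVlt => /predU1P[->|kl] v.
  by rewrite opathkk; exists (oid1 v).
rewrite opathS //; have [p <-] := IHl kl v; have [e /esym/eqP pe] := Es l (rng p).
by exists (exist _ (p, e) pe).
Qed.

Lemma opath_rng : (forall n (v : V n.+1), exists e : E n, rng e = v) ->
  forall k l, k <= l -> forall v : V l, exists e : opath E k l, rng e = v.
Proof.
move=> Er k; elim=> [|l IHl].
  by rewrite leqn0 => /eqP-> v; exists (oid1 v).
rewrite leq_eqVlt => /predU1P[->|kl] v.
  by rewrite opathkk; exists (oid1 v).
rewrite opathS //; have [e <-] := Er l v; have [p /eqP pe] := IHl kl (src e).
by exists (exist _ (p, e) pe).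
Qed.

End PathTheory.

Lemma lev_mono B C (f : opremor B C) k l : k <= l -> lev f k <= lev f l.
Proof. by move=> kl; apply: (homo_leq leqnn leq_trans (@lev_homo _ _ f)). Qed.

Lemma opremor_comm B C (f : opremor B C) k l : k <= l ->
  oiso (epath B k l \oc pedg f l) (pedg f k \oc epath C (lev f k) (lev f l)).
Proof.
elim: l => [|l IHl].
  rewrite leqn0 => /eqP->; rewrite /epath !opathkk.
  exact: oiso_trans (ocomp1 _) (oiso_sym (ocomp1r _)).
rewrite leq_eqVlt => /predU1P[->|kl].
  rewrite /epath !opathkk.
  exact: oiso_trans (ocomp1 _) (oiso_sym (ocomp1r _)).
rewrite /epath opathS //; rewrite ltnS in kl.
apply: oiso_trans (ocompA _ _ _) _.
apply: oiso_trans (ocomp_iso (oiso_refl _) (pedg_comm f l)) _.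
apply: oiso_trans (oiso_sym (ocompA _ _ _)) _.
apply: oiso_trans (ocomp_iso (IHl kl) (oiso_refl _)) _.
apply: oiso_trans (ocompA _ _ _) _.
apply: ocomp_iso (oiso_refl _) (oiso_sym _).
by apply: opath_cat; rewrite lev_mono //= lev_homo.
Qed.

Section PremorphismComposition.
Variables (B C D : obd) (g : opremor C D) (f : opremor B C).

Definition pcomp_lev n := lev g (lev f n).
Definition pcomp_edg n : oedges (vtx B n) (vtx D (pcomp_lev n)) :=
  pedg f n \oc pedg g (lev f n).

Lemma pcomp_lev0 : pcomp_lev 0 = 0.
Proof. by rewrite /pcomp_lev !lev0. Qed.

Lemma pcomp_lev_homo n : pcomp_lev n <= pcomp_lev n.+1.
Proof. exact/lev_mono/lev_homo. Qed.

Lemma pcomp_lev_unbounded N : exists n, N <= pcomp_lev n.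
Proof.
have [m Nm] := lev_unbounded g N; have [n mn] := lev_unbounded f m.
by exists n; apply: leq_trans Nm (lev_mono g mn).
Qed.

Lemma pcomp_src n (v : vtx B n) : exists e : pcomp_edg n, src e = v.
Proof.
have [e <-] := pedg_src f v; have [e' /esym/eqP ee'] := pedg_src g (rng e).
by exists (exist _ (e, e') ee').
Qed.

Lemma pcomp_rng n (w : vtx D (pcomp_lev n)) : exists e : pcomp_edg n, rng e = w.
Proof.
have [e' <-] := pedg_rng w; have [e /eqP ee'] := pedg_rng (src e').
by exists (exist _ (e, e') ee').
Qed.

Lemma pcomp_gt0 n : 0 < #|pcomp_edg n|.
Proof.
have /card_gt0P[v _] := vtx_gt0 B n; have [e _] := pcomp_src v.
by apply/card_gt0P; exists e.
Qed.

Lemma pcomp0 : #|pcomp_edg 0| = 1.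
Proof.
have g0 : #|pedg g (lev f 0)| <= 1 by rewrite lev0 pedg0.
have f0 : #|pedg f 0| <= 1 by rewrite pedg0.
apply/eqP; rewrite eqn_leq pcomp_gt0 andbT; apply/card_le1_eqP => p q _ _.
apply: val_inj; case: (val p) (val q) => [a b] [c d].
by rewrite (card_le1_eqP f0 a c) // (card_le1_eqP g0 b d).
Qed.

Lemma pcomp_comm n :
  oiso (edg B n \oc pcomp_edg n.+1)
       (pcomp_edg n \oc epath D (pcomp_lev n) (pcomp_lev n.+1)).
Proof.
apply: oiso_trans (oiso_sym (ocompA _ _ _)) _.
apply: oiso_trans (ocomp_iso (pedg_comm f n) (oiso_refl _)) _.
apply: oiso_trans (ocompA _ _ _) _.
apply: oiso_trans (ocomp_iso (oiso_refl _) (opremor_comm g (lev_homo f n))) _.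
exact: oiso_sym (ocompA _ _ _).
Qed.

Definition pcomp : opremor B D :=
  @OPremor B D pcomp_lev pcomp_edg pcomp_lev0 pcomp_lev_homo pcomp_lev_unbounded pcomp_gt0
    pcomp_src pcomp_rng pcomp0 pcomp_comm.

End PremorphismComposition.

(* The sequences (n_k) and (m_k), k >= 1, are indexed from 0. *)
Definition opremor_equiv (B C : obd) (f g : opremor B C) : Prop :=
  exists n m : nat -> nat, forall k,
    [/\ 0 < n k /\ 0 < m k,
        n k < m k < n k.+1,
        lev f (n k) < lev g (m k) < lev f (n k.+1),
        oiso (epath B (n k) (m k) \oc pedg g (m k))
             (pedg f (n k) \oc epath C (lev f (n k)) (lev g (m k))) &
        oiso (epath B (m k) (n k.+1) \oc pedg f (n k.+1))
             (pedg g (m k) \oc epath C (lev g (m k)) (lev f (n k.+1)))].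

Definition opremor_class (B C : obd) (f : opremor B C) : opremor B C -> Prop :=
  fun g => opremor_equiv f g.

Record omor (B C : obd) := OMor {
  omor_set : opremor B C -> Prop;
  omor_classP : exists f, omor_set = opremor_class f }.

Definition omor_of (B C : obd) (f : opremor B C) : omor B C :=
  OMor (ex_intro _ f erefl).

Record category (ob : Type) (hom : ob -> ob -> Type) := Category {
  cat_id : forall A, hom A A;
  cat_comp : forall A B C, hom B C -> hom A B -> hom A C;
  cat_compA : forall A B C D (h : hom C D) (g : hom B C) (f : hom A B),
    cat_comp h (cat_comp g f) = cat_comp (cat_comp h g) f;
  cat_comp1f : forall A B (f : hom A B), cat_comp (cat_id B) f = f;
  cat_compf1 : forall A B (f : hom A B), cat_comp f (cat_id A) = f }.

Arguments cat_id {ob hom} _ A.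
Arguments cat_comp {ob hom} _ {A B C}.

Definition cat_isomorphic (ob : Type) (hom : ob -> ob -> Type)
    (K : category hom) (A B : ob) : Prop :=
  exists (f : hom A B) (g : hom B A),
    cat_comp K g f = cat_id K A /\ cat_comp K f g = cat_id K B.

Section Telescoping.
Variables (B : obd) (n : nat -> nat).
Hypotheses (n0 : n 0 = 0) (n_lt : forall k, n k < n k.+1).

Definition tele_vtx k : finType := vtx B (n k).
Definition tele_edg k : oedges (tele_vtx k) (tele_vtx k.+1) :=
  epath B (n k) (n k.+1).

Lemma tele_vtx_gt0 k : 0 < #|tele_vtx k|.
Proof. exact: vtx_gt0. Qed.

Lemma tele_vtx0 : #|tele_vtx 0| = 1.
Proof. by rewrite /tele_vtx n0 vtx0. Qed.

Lemma tele_src k (v : tele_vtx k) : exists e : tele_edg k, src e = v.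
Proof. exact: (opath_src (@edg_src B) (ltnW (n_lt k))). Qed.

Lemma tele_rng k (v : tele_vtx k.+1) : exists e : tele_edg k, rng e = v.
Proof. exact: (opath_rng (@edg_rng B) (ltnW (n_lt k))). Qed.

Lemma tele_edg_gt0 k : 0 < #|tele_edg k|.
Proof.
have /card_gt0P[v _] := tele_vtx_gt0 k; have [e _] := tele_src v.
by apply/card_gt0P; exists e.
Qed.

Definition telescope : obd :=
  @OBDiagram tele_vtx tele_edg tele_vtx_gt0 tele_vtx0 tele_edg_gt0 tele_src tele_rng.

End Telescoping.

Definition obd_iso (B C : obd) : Prop :=
  exists (phi : forall n, vtx B n -> vtx C n)
         (psi : forall n, edg B n -> edg C n),
    [/\ (forall n, bijective (phi n)) /\ (forall n, bijective (psi n)),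
        forall n (e : edg B n), src (psi n e) = phi n (src e),
        forall n (e : edg B n), rng (psi n e) = phi n.+1 (rng e) &
        forall n (e e' : edg B n), ole (psi n e) (psi n e') = ole e e'].

Inductive hps_step : obd -> obd -> Prop :=
| hps_iso B C : obd_iso B C -> hps_step B C
| hps_telescope B n (n0 : n 0 = 0) (n_lt : forall k, n k < n k.+1) :
    hps_step B (telescope B n0 n_lt).

Definition hps_equiv : obd -> obd -> Prop := clos_refl_sym_trans obd hps_step.

(* Main.v *)
From Stdlib Require Import Setoid Morphisms Relations.Relation_Operators.
From Stdlib Require Import FunctionalExtensionality PropExtensionality.
From Stdlib Require Import ProofIrrelevance IndefiniteDescription.
From mathcomp Require Import all_boot.
Require Import Defs.

(** The whole proof rests on one relation.  For premorphisms f, g : B -> C and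
levels n <= m, say that f at level n and g at level m are intertwined if
f_n <= g_m and E_{n,m} o G_m is isomorphic to F_n o S_{f_n,g_m}
([intertwined]).  This relation composes ([intertwined_trans]), and
f is intertwined with itself at all n <= m.  Hence f ~ g holds iff every level
n of f is intertwined with all sufficiently high levels of g, and conversely
([opremor_equivP]).  In this form it is clear that ~ is an equivalence relation
and a congruence for composition ([pcomp_equiv]); the category axioms then
follow from the associativity and unit laws of edge sets up to isomorphism.

An isomorphism of diagrams gives a pair of inverse premorphisms whose edge sets
are the graphs of the bijections of vertices.  A telescoping T of B along (n_k)
gives the premorphism B -> T with edge sets E_{k,n_k}, and the premorphism
T -> B with levels n_k and identity edge sets; these are inverse to each
other up to ~ ([telescope_isomorphic]).  So equivalent diagrams are isomorphic.

Conversely, let f : B -> C and g : C -> B be inverse to each other up to ~.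
Choose levels 0 = c_0 < c_1 < ... growing so fast that the composites
F_{c_k} o S_{f_{c_k},c_{k+1}} and G_{c_k} o E_{g_{c_k},c_{k+1}} are defined and
that the edge set of gf at level c_k, followed by the paths to level c_{k+2},
is isomorphic to E_{c_k,c_{k+2}}, and likewise for fg.  The diagram with levels
V_{c_0}, W_{c_1}, V_{c_2}, W_{c_3}, ... and these edge sets ([interleave])
telescopes along the even levels to a telescoping of B ([interleave_even]), and
along 0 and the odd levels to a telescoping of C ([interleave_odd]). *)

Set Implicit Arguments.
Unset Strict Implicit.
Unset Printing Implicit Defensive.

(** * Edge sets and paths *)

#[local] Instance oiso_equivalence (S T : finType) : Equivalence (@oiso S T).
Proof.
split; [exact: oiso_refl | exact: oiso_sym | exact: oiso_trans].
Qed.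

#[local] Instance ocomp_proper (S T U : finType) :
  Proper (@oiso S T ==> @oiso T U ==> @oiso S U) (@ocomp S T U).
Proof. by move=> F F' FF' G G' GG'; apply: ocomp_iso. Qed.

Lemma ocomp_src_surj (S T U : finType) (F : oedges S T) (G : oedges T U) :
  (forall v, exists e : F, src e = v) -> (forall v, exists e : G, src e = v) ->
  forall v, exists e : F \oc G, src e = v.
Proof.
move=> Fs Gs v; have [e <-] := Fs v; have [g /esym/eqP eg] := Gs (rng e).
by exists (exist _ (e, g) eg).
Qed.

Lemma ocomp_rng_surj (S T U : finType) (F : oedges S T) (G : oedges T U) :
  (forall v, exists e : F, rng e = v) -> (forall v, exists e : G, rng e = v) ->
  forall v, exists e : F \oc G, rng e = v.
Proof.
move=> Fr Gr v; have [g <-] := Gr v; have [e /eqP eg] := Fr (src g).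
by exists (exist _ (e, g) eg).
Qed.

Lemma src_surj_gt0 (S T : finType) (F : oedges S T) :
  0 < #|S| -> (forall v, exists e : F, src e = v) -> 0 < #|F|.
Proof.
by case/card_gt0P=> v _ Fs; have [e _] := Fs v; apply/card_gt0P; exists e.
Qed.

Lemma epath_cat (B : obd) k l m : k <= l -> l <= m ->
  oiso (epath B k l \oc epath B l m) (epath B k m).
Proof. by move=> kl lm; apply/oiso_sym/opath_cat; rewrite kl. Qed.

Lemma epath1 (B : obd) k : oiso (epath B k k.+1) (edg B k).
Proof. by rewrite /epath opathS // opathkk; apply: ocomp1. Qed.

Lemma increasing_ge_id (n : nat -> nat) :
  (forall k, n k < n k.+1) -> forall k, k <= n k.
Proof. by move=> n_lt; elim=> // k /leq_ltn_trans; apply. Qed.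

(** * Equivalence of premorphisms *)

Section Intertwining.
Variables B C : obd.
Implicit Types f g h : opremor B C.

(** Level [n] of [f] and level [m] of [g] agree, up to the paths from [n] to [m]
in the source and from [lev f n] to [lev g m] in the target.  The conditions of
[opremor_equiv] are instances of this relation. *)
Definition intertwined f g n m :=
  [/\ n <= m, lev f n <= lev g m &
      oiso (epath B n m \oc pedg g m)
           (pedg f n \oc epath C (lev f n) (lev g m))].

Lemma intertwined_refl f n m : n <= m -> intertwined f f n m.
Proof. by move=> nm; split=> //; [apply: lev_mono | apply: opremor_comm]. Qed.

Lemma intertwined_trans f g h n m l :
  intertwined f g n m -> intertwined g h m l -> intertwined f h n l.
Proof.
case=> nm fg efg [ml gh egh].
split; [exact: leq_trans ml | exact: leq_trans gh |].
rewrite -(epath_cat _ nm ml) ocompA egh -ocompA efg ocompA.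
rewrite epath_cat //; reflexivity.
Qed.

(** Every level of [f] is intertwined with all large levels of [g]. *)
Definition dominated f g :=
  forall n, exists N, forall m, N <= m -> intertwined f g n m.

Lemma dominated_refl f : dominated f f.
Proof. by move=> n; exists n; apply: intertwined_refl. Qed.

Lemma dominated_trans f g h : dominated f g -> dominated g h -> dominated f h.
Proof.
move=> fg gh n; have [m /(_ m (leqnn m)) nm] := fg n; have [N ml] := gh m.
by exists N => l /ml; apply: intertwined_trans nm.
Qed.

Lemma lev_eventually_ge f x : exists N, forall m, N <= m -> x <= lev f m.
Proof.
have [N xN] := lev_unbounded f x; exists N => m /(lev_mono f).
exact: leq_trans.
Qed.

(** The zigzag of the definition of equivalence composes to give intertwinings
at all large levels; conversely a zigzag is found by choosing each level large
relative to the preceding one. *)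
Lemma opremor_equivP f g :
  opremor_equiv f g <-> dominated f g /\ dominated g f.
Proof.
split=> [[n [m nm]]|[fg gf]].
  have n_ge k : k <= n k.
    apply: increasing_ge_id => {}k; have [_ /andP[lt1 lt2] _ _ _] := nm k.
    exact: ltn_trans lt2.
  have fg k : intertwined f g (n k) (m k).
    by have [_ /andP[/ltnW ? _] /andP[/ltnW ? _] ? _] := nm k.
  have gf k : intertwined g f (m k) (n k.+1).
    by have [_ /andP[_ /ltnW ?] /andP[_ /ltnW ?] _ ?] := nm k.
  split=> i.
    exists (m i) => j mj; apply: intertwined_trans (intertwined_refl g mj).
    exact: intertwined_trans (intertwined_refl f (n_ge i)) (fg i).
  exists (n i.+1) => j nj; apply: intertwined_trans (intertwined_refl f nj).
  apply: intertwined_trans (gf i); apply: intertwined_refl.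
  by apply: leq_trans (n_ge i) _; have [] := fg i.
have big n : exists N, [/\ n < N, lev f n < lev g N, lev g n < lev f N,
    intertwined f g n N & intertwined g f n N].
  have [N1 H1] := fg n; have [N2 H2] := gf n.
  have [N3 H3] := lev_eventually_ge g (lev f n).+1.
  have [N4 H4] := lev_eventually_ge f (lev g n).+1.
  exists (\max_(i <- [:: n.+1; N1; N2; N3; N4]) i).
  rewrite !big_cons big_nil.
  split; [|apply: H3 | apply: H4 | apply: H1 | apply: H2];
    by rewrite !leq_max leqnn ?orbT.
(* Both sequences of levels are alternate terms of one orbit of [u]. *)
pose u n := sval (constructive_indefinite_description _ (big n)).
have uP n : [/\ n < u n, lev f n < lev g (u n), lev g n < lev f (u n),
    intertwined f g n (u n) & intertwined g f n (u n)].
  exact: svalP (constructive_indefinite_description _ (big n)).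
exists (fun k => iter k (u \o u) 1), (fun k => u (iter k (u \o u) 1)) => k /=.
set x := iter k _ _.
have x0 : 0 < x.
  rewrite /x; elim: k {x} => //= k IHk.
  have [lt1 _ _ _ _] := uP (iter k (u \o u) 1).
  have [lt2 _ _ _ _] := uP (u (iter k (u \o u) 1)).
  exact: ltn_trans (ltn_trans IHk lt1) lt2.
have [lt1 fg1 _ [_ _ R1] _] := uP x; have [lt2 _ gf2 _ [_ _ R2]] := uP (u x).
by rewrite lt1 lt2 fg1 gf2 x0 (ltn_trans x0 lt1).
Qed.

Lemma opremor_equiv_refl f : opremor_equiv f f.
Proof. by apply/opremor_equivP; split; apply: dominated_refl. Qed.

Lemma opremor_equiv_sym f g : opremor_equiv f g -> opremor_equiv g f.
Proof. by move/opremor_equivP=> [fg gf]; apply/opremor_equivP. Qed.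

Lemma opremor_equiv_trans f g h :
  opremor_equiv f g -> opremor_equiv g h -> opremor_equiv f h.
Proof.
move/opremor_equivP=> [fg gf] /opremor_equivP[gh hg]; apply/opremor_equivP.
by split; [apply: dominated_trans gh | apply: dominated_trans gf].
Qed.

(** Premorphisms with the same levels and isomorphic edge sets are equivalent.
The cast along [e] is the identity when the two level functions are
convertible, which is the case in all uses. *)
Lemma equiv_pedg_iso f g (e : lev g = lev f) :
  (forall n, oiso (pedg f n)
     (ecast l (oedges (vtx B n) (vtx C (l n))) e (pedg g n))) ->
  opremor_equiv f g.
Proof.
case: f g e => lf F f0 fh fu Fg Fs Fr F0 Fc [lg G g0 gh gu Gg Gs Gr G0 Gc] /= e.
case: lf / e F f0 fh fu Fg Fs Fr F0 Fc => F f0 fh fu Fg Fs Fr F0 Fc /= FG.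
set f := OPremor f0 _ _ _ _ _ _ _; set g := OPremor g0 _ _ _ _ _ _ _.
have FG' n : oiso (pedg f n) (pedg g n) := FG n.
apply/opremor_equivP; split=> n; exists n => m nm; split=> //;
  try by apply: (lev_mono f nm).
  by have := opremor_comm f nm; rewrite FG'.
by have := opremor_comm g nm; rewrite -FG'.
Qed.

End Intertwining.

Lemma pcomp_dominated (B C D : obd) (f f' : opremor B C) (g g' : opremor C D) :
  dominated f f' -> dominated g g' -> dominated (pcomp g f) (pcomp g' f').
Proof.
move=> ff' gg' n; have [N1 H1] := ff' n; have [N2 H2] := gg' (lev f n).
have [N3 H3] := lev_eventually_ge f' N2.
exists (maxn N1 N3) => m; rewrite geq_max.
case/andP=> /H1[nm le1 R1] /H3/H2[_ le2 R2].
split=> //; rewrite /= /pcomp_edg.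
rewrite -ocompA R1 ocompA R2 -ocompA; reflexivity.
Qed.

Lemma pcomp_equiv (B C D : obd) (f f' : opremor B C) (g g' : opremor C D) :
  opremor_equiv f f' -> opremor_equiv g g' ->
  opremor_equiv (pcomp g f) (pcomp g' f').
Proof.
move/opremor_equivP=> [ff' f'f] /opremor_equivP[gg' g'g]; apply/opremor_equivP.
by split; apply: pcomp_dominated.
Qed.

(** * The category *)

Section IdentityPremorphism.
Variable B : obd.

Definition pid_edg n : oedges (vtx B n) (vtx B n) := oid (vtx B) n n.

Lemma pid_src n (v : vtx B n) : exists e : pid_edg n, src e = v.
Proof. by exists (oid1 v). Qed.

Lemma pid_rng n (v : vtx B n) : exists e : pid_edg n, rng e = v.
Proof. by exists (oid1 v). Qed.

Lemma pid_gt0 n : 0 < #|pid_edg n|.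
Proof. exact: src_surj_gt0 (vtx_gt0 B n) (@pid_src n). Qed.

Lemma pid0 : #|pid_edg 0| = 1.
Proof.
apply/eqP; rewrite eqn_leq pid_gt0 andbT; apply/card_le1_eqP => p q _ _.
have V0 : #|vtx B 0| <= 1 by rewrite vtx0.
by rewrite -[p]oid1_rng -[q]oid1_rng (card_le1_eqP V0 (rng p) (rng q)).
Qed.

Lemma pid_comm n :
  oiso (edg B n \oc pid_edg n.+1) (pid_edg n \oc epath B n n.+1).
Proof. rewrite ocomp1r ocomp1 epath1; reflexivity. Qed.

(** The identity premorphism: level [n] consists of one edge at each vertex. *)
Definition pid : opremor B B :=
  @OPremor B B id pid_edg erefl (fun n => leqnSn n)
    (fun N => ex_intro _ N (leqnn N)) pid_gt0 pid_src pid_rng pid0 pid_comm.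

End IdentityPremorphism.

Section Category.

Lemma omor_set_inj (B C : obd) (X Y : omor B C) :
  omor_set X = omor_set Y -> X = Y.
Proof.
case: X Y => X Xc [Y Yc] /= eXY; case: Y / eXY Yc => Xc'.
by congr OMor; apply: proof_irrelevance.
Qed.

Lemma omor_ofP (B C : obd) (X : omor B C) : exists f, X = omor_of f.
Proof. by have [f Xf] := omor_classP X; exists f; apply: omor_set_inj. Qed.

Lemma omor_of_eq (B C : obd) (f g : opremor B C) :
  omor_of f = omor_of g <-> opremor_equiv f g.
Proof.
split=> [[/(congr1 (fun P => P g))]|fg].
  by rewrite /opremor_class => ->; exact: opremor_equiv_refl.
apply: omor_set_inj; apply: functional_extensionality => h.
apply: propositional_extensionality; split; rewrite /= /opremor_class.
  exact/opremor_equiv_trans/opremor_equiv_sym.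
exact: opremor_equiv_trans.
Qed.

Variables B C D : obd.

(** The composite class, defined without a choice of representatives. *)
Definition omor_comp_set (Y : omor C D) (X : omor B C) : opremor B D -> Prop :=
  fun h => exists f g,
    [/\ omor_set X f, omor_set Y g & opremor_equiv (pcomp g f) h].

Lemma omor_comp_set_of (g : opremor C D) (f : opremor B C) :
  omor_comp_set (omor_of g) (omor_of f) = opremor_class (pcomp g f).
Proof.
apply: functional_extensionality => h.
apply: propositional_extensionality; split.
  by case=> f' [g' [ff' gg']]; apply/opremor_equiv_trans/pcomp_equiv.
by exists f, g; split=> //; apply: opremor_equiv_refl.
Qed.

Lemma omor_comp_classP (Y : omor C D) (X : omor B C) :
  exists h, omor_comp_set Y X = opremor_class h.
Proof.
have [f ->] := omor_ofP X; have [g ->] := omor_ofP Y.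
by exists (pcomp g f); apply: omor_comp_set_of.
Qed.

Definition omor_comp (Y : omor C D) (X : omor B C) : omor B D :=
  OMor (omor_comp_classP Y X).

Lemma omor_comp_of (g : opremor C D) (f : opremor B C) :
  omor_comp (omor_of g) (omor_of f) = omor_of (pcomp g f).
Proof. by apply: omor_set_inj; apply: omor_comp_set_of. Qed.

End Category.

Definition omor_id (B : obd) : omor B B := omor_of (pid B).

Lemma omor_compA (A B C D : obd) (Z : omor C D) (Y : omor B C) (X : omor A B) :
  omor_comp Z (omor_comp Y X) = omor_comp (omor_comp Z Y) X.
Proof.
have [f ->] := omor_ofP X; have [g ->] := omor_ofP Y; have [h ->] := omor_ofP Z.
rewrite !omor_comp_of; apply/omor_of_eq.
apply: (@equiv_pedg_iso _ _
  (pcomp h (pcomp g f)) (pcomp (pcomp h g) f) erefl) => n /=.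
exact: ocompA.
Qed.

Lemma omor_comp1f (B C : obd) (X : omor B C) : omor_comp (omor_id C) X = X.
Proof.
have [f ->] := omor_ofP X; rewrite omor_comp_of.
apply/omor_of_eq.
apply: (@equiv_pedg_iso _ _ (pcomp (pid C) f) f erefl) => n /=.
exact: ocomp1r.
Qed.

Lemma omor_compf1 (B C : obd) (X : omor B C) : omor_comp X (omor_id B) = X.
Proof.
have [f ->] := omor_ofP X; rewrite omor_comp_of.
apply/omor_of_eq.
apply: (@equiv_pedg_iso _ _ (pcomp f (pid B)) f erefl) => n /=.
exact: ocomp1.
Qed.

Definition OBD : category omor :=
  @Category obd omor omor_id omor_comp omor_compA omor_comp1f omor_compf1.

(** Isomorphism in [OBD], expressed with representatives. *)
Definition obd_isomorphic (B C : obd) : Prop :=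
  exists (f : opremor B C) (g : opremor C B),
    opremor_equiv (pcomp g f) (pid B) /\ opremor_equiv (pcomp f g) (pid C).

Lemma cat_isomorphicE (B C : obd) :
  cat_isomorphic OBD B C <-> obd_isomorphic B C.
Proof.
split=> [[X [Y]]|[f [g [gf fg]]]].
  have [f ->] := omor_ofP X; have [g ->] := omor_ofP Y.
  rewrite /= !omor_comp_of => -[/omor_of_eq gf /omor_of_eq fg].
  by exists f, g.
exists (omor_of f), (omor_of g); rewrite /= !omor_comp_of.
by split; apply/omor_of_eq.
Qed.

Lemma cat_isomorphic_trans (B C D : obd) :
  cat_isomorphic OBD B C -> cat_isomorphic OBD C D -> cat_isomorphic OBD B D.
Proof.
case=> f [f' [f'f ff']] [g [g' [g'g gg']]].
exists (cat_comp OBD g f), (cat_comp OBD f' g'); split.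
  by rewrite -cat_compA [cat_comp OBD g' _]cat_compA g'g cat_comp1f.
by rewrite -cat_compA [cat_comp OBD f _]cat_compA ff' cat_comp1f.
Qed.

(** * Equivalent diagrams are isomorphic *)

(** Isomorphism of ordered edge sets lying over given maps of the source and
target vertices; [oiso] is the case of two identity maps. *)
Definition oiso_over (S T S' T' : finType) (phi : S -> S') (chi : T -> T')
    (F : oedges S T) (F' : oedges S' T') : Prop :=
  exists psi : F -> F',
    [/\ bijective psi,
        forall e, src (psi e) = phi (src e),
        forall e, rng (psi e) = chi (rng e) &
        forall e e', ole (psi e) (psi e') = ole e e'].

Section OisoOver.
Variables (S T S' T' : finType) (phi : S -> S') (chi : T -> T').

Lemma oiso_over_iso (F G : oedges S T) (F' G' : oedges S' T') :
  oiso F G -> oiso F' G' -> oiso_over phi chi G G' -> oiso_over phi chi F F'.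
Proof.
case=> f [fb fs fr fo] /oiso_sym[f' [f'b f's f'r f'o]] [psi [pb ps pr po]].
exists (f' \o psi \o f); split.
- exact/bij_comp/fb/bij_comp.
- by move=> e; rewrite /= f's ps fs.
- by move=> e; rewrite /= f'r pr fr.
- by move=> e e'; rewrite /= f'o po fo.
Qed.

End OisoOver.

Lemma obd_iso_of_over (B C : obd) (phi : forall n, vtx B n -> vtx C n) :
  (forall n, bijective (phi n)) ->
  (forall n, oiso_over (phi n) (phi n.+1) (edg B n) (edg C n)) ->
  obd_iso B C.
Proof.
move=> phi_bij over.
pose psi n := sval (constructive_indefinite_description _ (over n)).
have psiP n := svalP (constructive_indefinite_description _ (over n)).
by exists phi, psi; split; [split=> //| | |] => n; case: (psiP n).
Qed.

Section Graph.
Variables (S T : finType) (phi : S -> T).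
Hypothesis phi_inj : injective phi.

Lemma graph_comparable (v w : S) : (v == w) || (w == v) = (phi v == phi w).
Proof. by rewrite [w == v]eq_sym orbb (inj_eq phi_inj). Qed.

Lemma eq_op_anti : antisymmetric (fun v w : S => v == w).
Proof. by move=> v w /andP[/eqP]. Qed.

Lemma eq_op_trans : transitive (fun v w : S => v == w).
Proof. by move=> v w x /eqP->. Qed.

(** The edge set with one edge from [v] to [phi v] for each [v].  As [phi] is
injective no two edges have the same range, so the order is equality. *)
Definition graph : oedges S T :=
  @OEdges _ _ S id phi (fun v w => v == w) (@eqxx _) eq_op_anti eq_op_trans
    graph_comparable.

End Graph.

(** Both sides are in bijection with [F]: in [F \oc graph] the second component
is determined by the first, in [graph \oc F'] the first by the second. *)
Lemma graph_comm (S T S' T' : finType) (phi : S -> S') (chi : T -> T')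
    (phi_inj : injective phi) (chi_inj : injective chi)
    (F : oedges S T) (F' : oedges S' T') :
  oiso_over phi chi F F' -> oiso (F \oc graph chi_inj) (graph phi_inj \oc F').
Proof.
case=> psi [[psi' psiK psi'K] ps pr po].
have hP (p : F \oc graph chi_inj) :
    rng (src (val p).1 : graph phi_inj) == src (psi (val p).1).
  by rewrite ps.
have kP (q : graph phi_inj \oc F') :
    rng (psi' (val q).2) == src (rng (psi' (val q).2) : graph chi_inj).
  by [].
exists (fun p => exist _ (src (val p).1 : graph phi_inj, psi (val p).1) (hP p)).
split=> //.
- exists (fun q => exist _ (psi' (val q).2,
    rng (psi' (val q).2) : graph chi_inj) (kP q)).
    move=> -[[e v] ev]; have ev' : rng e = v := eqP ev.
    by apply: val_inj; rewrite /= psiK ev'.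
  move=> -[[v e] ve]; have ve' : phi v = src e := eqP ve.
  apply: val_inj; rewrite /= psi'K; congr pair.
  by apply/phi_inj; rewrite -ps psi'K ve'.
- move=> p; rewrite /= /ocomp_rng /= pr; congr chi; exact: eqP (valP p).
move=> p q; rewrite /= !ocomp_leE /= po.
have Ep : rng (val p).1 = (val p).2 := eqP (valP p).
have Eq : rng (val q).1 = (val q).2 := eqP (valP q).
rewrite (can_eq psiK) -Ep -Eq; case: eqVneq => [->|_].
  by rewrite !eqxx ole_refl.
by case: eqVneq => // ne; apply/negP => le; case/eqP: ne; apply/eqP;
  rewrite -ole_comparable le.
Qed.

Lemma graph_can (V : nat -> finType) n (T : finType) (phi : V n -> T)
    (chi : T -> V n) (phi_inj : injective phi) (chi_inj : injective chi) :
  cancel phi chi -> oiso (graph phi_inj \oc graph chi_inj) (oid V n n).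
Proof.
move=> phiK.
have kP (q : oid V n n) :
    rng (src q : graph phi_inj) == src (phi (src q) : graph chi_inj) by [].
exists (fun p => oid1 (val p).1); split=> //.
- exists (fun q => exist _ (src q : graph phi_inj,
    phi (src q) : graph chi_inj) (kP q)).
    case=> -[v w] vw; have vw' : phi v = w := eqP vw.
    by apply: val_inj; rewrite /= vw'.
  by move=> q; rewrite -[RHS]oid1_rng -oidE.
- by move=> p; have /eqP/= := valP p; rewrite /= /ocomp_rng /= => <-.
- move=> p q; rewrite /= ocomp_leE /=.
  have <- : phi (val p).1 = (val p).2 := eqP (valP p).
  have <- : phi (val q).1 = (val q).2 := eqP (valP q).
  rewrite (inj_eq phi_inj) if_same.
  by rewrite -val_eqE /= xpair_eqE andbb; case: eqP.
Qed.

Section GraphPremorphism.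
Variables (B C : obd) (phi : forall n, vtx B n -> vtx C n).
Hypothesis phi_bij : forall n, bijective (@phi n).
Hypothesis over : forall n, oiso_over (@phi n) (@phi n.+1) (edg B n) (edg C n).

Let phi_inj n : injective (@phi n) := bij_inj (@phi_bij n).
Definition pgraph_edg n : oedges (vtx B n) (vtx C n) := graph (@phi_inj n).

Lemma pgraph_src n (v : vtx B n) : exists e : pgraph_edg n, src e = v.
Proof. by exists v. Qed.

Lemma pgraph_rng n (w : vtx C n) : exists e : pgraph_edg n, rng e = w.
Proof. by have [psi _ psiK] := @phi_bij n; exists (psi w); apply: psiK. Qed.

Lemma pgraph_gt0 n : 0 < #|pgraph_edg n|.
Proof. exact: src_surj_gt0 (vtx_gt0 B n) (@pgraph_src n). Qed.

Lemma pgraph0 : #|pgraph_edg 0| = 1.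
Proof. exact: vtx0. Qed.

Lemma pgraph_comm n :
  oiso (edg B n \oc pgraph_edg n.+1) (pgraph_edg n \oc epath C n n.+1).
Proof. by rewrite epath1; apply: graph_comm. Qed.

(** The premorphism of an isomorphism of diagrams. *)
Definition pgraph : opremor B C :=
  @OPremor B C id pgraph_edg erefl (fun n => leqnSn n)
    (fun N => ex_intro _ N (leqnn N)) pgraph_gt0 pgraph_src pgraph_rng pgraph0
    pgraph_comm.

End GraphPremorphism.

Lemma bijective_inverse (S T : Type) (f : S -> T) :
  bijective f -> exists g : T -> S, cancel f g /\ cancel g f.
Proof. by case=> g fK gK; exists g. Qed.

Lemma obd_iso_isomorphic (B C : obd) : obd_iso B C -> obd_isomorphic B C.
Proof.
case=> phi [psi [[phi_bij psi_bij] ps pr po]].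
pose phi_inv n :=
  constructive_indefinite_description _ (bijective_inverse (phi_bij n)).
pose phi' n := sval (phi_inv n).
have phiK n : cancel (phi n) (phi' n) := proj1 (svalP (phi_inv n)).
have phi'K n : cancel (phi' n) (phi n) := proj2 (svalP (phi_inv n)).
have phi'_bij n : bijective (phi' n) by exists (phi n).
have over n : oiso_over (phi n) (phi n.+1) (edg B n) (edg C n).
  by exists (psi n); split.
have over' n : oiso_over (phi' n) (phi' n.+1) (edg C n) (edg B n).
  have [psi' psiK psi'K] := psi_bij n; exists psi'; split.
  - by exists (psi n).
  - by move=> e; rewrite -{2}[e]psi'K ps phiK.
  - by move=> e; rewrite -{2}[e]psi'K pr phiK.
  - by move=> e e'; rewrite -po !psi'K.
pose f := pgraph phi_bij over; pose g := pgraph phi'_bij over'.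
exists f, g; split.
  apply: (@equiv_pedg_iso _ _ (pcomp g f) (pid B) erefl) => n /=.
  exact: graph_can.
apply: (@equiv_pedg_iso _ _ (pcomp f g) (pid C) erefl) => n /=.
exact: graph_can.
Qed.

Section TelescopingPremorphisms.
Variables (B : obd) (n : nat -> nat).
Hypotheses (n0 : n 0 = 0) (n_lt : forall k, n k < n k.+1).

Let T := telescope B n0 n_lt.
Let n_ge k : k <= n k := increasing_ge_id n_lt k.
Let n_mono k l : k <= l -> n k <= n l.
Proof. by apply: (homo_leq leqnn leq_trans) => i; apply: ltnW. Qed.

(** Paths of the telescoping are paths of the diagram. *)
Lemma epath_telescope k l : k <= l ->
  @oiso (vtx B (n k)) (vtx B (n l)) (epath T k l) (epath B (n k) (n l)).
Proof.
have epath0 i :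
    @oiso (vtx B (n i)) (vtx B (n i)) (epath T i i) (epath B (n i) (n i)).
  rewrite /epath !opathkk.
  apply: oiso_trans _ (@ocomp1 (vtx T) i _ (oid (vtx B) (n i) (n i))).
  exact: oiso_sym (@ocomp1r (vtx B) (n i) _ (oid (vtx T) i i)).
elim: l => [|l IHl]; first by rewrite leqn0 => /eqP->.
rewrite leq_eqVlt => /predU1P[-> //|]; rewrite ltnS => kl.
rewrite [epath T k l.+1]opathS //.
apply: oiso_trans (ocomp_iso (IHl kl) (oiso_refl _)) _.
exact: epath_cat (n_mono kl) (ltnW (n_lt l)).
Qed.

Definition to_tele_edg k : oedges (vtx B k) (vtx T k) := epath B k (n k).

Lemma to_tele_src k (v : vtx B k) : exists e : to_tele_edg k, src e = v.
Proof. exact: (opath_src (@edg_src B) (n_ge k)). Qed.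

Lemma to_tele_rng k (w : vtx T k) : exists e : to_tele_edg k, rng e = w.
Proof. exact: (opath_rng (@edg_rng B) (n_ge k)). Qed.

Lemma to_tele_gt0 k : 0 < #|to_tele_edg k|.
Proof. exact: src_surj_gt0 (vtx_gt0 B k) (@to_tele_src k). Qed.

Lemma to_tele0 : #|to_tele_edg 0| = 1.
Proof.
change (#|epath B 0 (n 0)| = 1); rewrite n0 /epath opathkk; exact: pid0.
Qed.

Lemma to_tele_comm k :
  oiso (edg B k \oc to_tele_edg k.+1) (to_tele_edg k \oc epath T k k.+1).
Proof.
apply: oiso_trans _
  (oiso_sym (ocomp_iso (oiso_refl _) (epath_telescope (leqnSn k)))).
rewrite -(epath1 B k) /to_tele_edg !epath_cat // ?(ltnW (n_lt _)) //.
reflexivity.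
Qed.

(** Level [k] consists of the paths in [B] from level [k] to level [n k]. *)
Definition to_tele : opremor B T :=
  @OPremor B T id to_tele_edg erefl (fun k => leqnSn k)
    (fun N => ex_intro _ N (leqnn N)) to_tele_gt0 to_tele_src to_tele_rng
    to_tele0 to_tele_comm.

Definition of_tele_edg k : oedges (vtx T k) (vtx B (n k)) := pid_edg B (n k).

Lemma of_tele0 : #|of_tele_edg 0| = 1.
Proof. change (#|pid_edg B (n 0)| = 1); rewrite n0; exact: pid0. Qed.

Lemma of_tele_comm k :
  oiso (edg T k \oc of_tele_edg k.+1)
       (of_tele_edg k \oc epath B (n k) (n k.+1)).
Proof.
exact: oiso_trans (@ocomp1r (vtx B) (n k.+1) _ (edg T k))
  (oiso_sym (@ocomp1 (vtx B) (n k) _ (epath B (n k) (n k.+1)))).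
Qed.

(** Level [k] of the telescoping is level [n k] of [B], so identity edge sets
serve. *)
Definition of_tele : opremor T B :=
  @OPremor T B n of_tele_edg n0 (fun k => ltnW (n_lt k))
    (fun N => ex_intro _ N (n_ge N)) (fun k => @pid_gt0 B (n k))
    (fun k => @pid_src B (n k)) (fun k => @pid_rng B (n k)) of_tele0
    of_tele_comm.

Lemma of_tele_to_tele : opremor_equiv (pcomp of_tele to_tele) (pid B).
Proof.
have pedgE k : oiso (pedg (pcomp of_tele to_tele) k) (epath B k (n k)).
  exact: (@ocomp1r (vtx B) (n k) _ (epath B k (n k))).
apply/opremor_equivP; split=> k.
  exists (n k) => m nm; split=> //; first exact: leq_trans (n_ge k) nm.
  apply: oiso_trans (ocomp1r _) _.
  apply: oiso_trans _ (ocomp_iso (oiso_sym (pedgE k)) (oiso_refl _)).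
  exact: oiso_sym (epath_cat B (n_ge k) nm).
exists k => m km; have km' : k <= n m := leq_trans km (n_ge m).
split=> //; apply: oiso_trans _ (oiso_sym (ocomp1 _)).
apply: oiso_trans (ocomp_iso (oiso_refl _) (pedgE m)) _.
exact (epath_cat B km (n_ge m)).
Qed.

Lemma to_tele_of_tele : opremor_equiv (pcomp to_tele of_tele) (pid T).
Proof.
apply/opremor_equivP; split=> k.
  exists (n k) => m nm; have km : k <= m := leq_trans (n_ge k) nm.
  split=> //=.
  apply: oiso_trans (ocomp1r _) _.
  apply: oiso_trans (epath_telescope km) _.
  apply: oiso_trans _
    (ocomp_iso (oiso_sym (ocomp1 _)) (oiso_sym (epath_telescope nm))).
  by rewrite /to_tele_edg; apply/oiso_sym/epath_cat => //; apply: n_mono.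
exists k => m km; have km' : k <= n m := leq_trans km (n_ge m).
split=> //=.
apply: oiso_trans _ (oiso_sym (ocomp1 _)).
apply: oiso_trans _ (oiso_sym (epath_telescope km')).
apply: oiso_trans (ocomp_iso (epath_telescope km) (ocomp1 _)) _.
by apply: epath_cat; apply: n_mono.
Qed.

Lemma telescope_isomorphic : obd_isomorphic B T.
Proof.
exists to_tele, of_tele.
by split; [exact: of_tele_to_tele | exact: to_tele_of_tele].
Qed.

End TelescopingPremorphisms.

Lemma hps_equiv_isomorphic (B C : obd) :
  hps_equiv B C -> cat_isomorphic OBD B C.
Proof.
elim=> {B C} [B C [{}B {}C|{}B n n0 n_lt]|B|B C _ [f [g [gf fg]]]
  |B C D _ BC _ CD].
- by move/obd_iso_isomorphic/cat_isomorphicE.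
- exact/cat_isomorphicE/telescope_isomorphic.
- by exists (cat_id OBD B), (cat_id OBD B); rewrite !cat_comp1f.
- by exists g, f.
- exact: cat_isomorphic_trans CD.
Qed.

(** * Isomorphic diagrams are equivalent *)

(** A single edge onto [T] forces [T] to be a point, so composition with it only
changes the sources. *)
Lemma oiso_over_single (S T U : finType) (F : oedges S T) (G : oedges T U)
    (phi : S -> T) :
  #|F| = 1 -> (forall w, exists e : F, rng e = w) ->
  oiso_over phi id (F \oc G) G.
Proof.
move=> F1 Fr; have F_le1 : #|F| <= 1 by rewrite F1.
have F_eq (e e' : F) : e = e' by apply: (card_le1_eqP F_le1).
have T_eq (w w' : T) : w = w'.
  by have [e <-] := Fr w; have [e' <-] := Fr w'; rewrite (F_eq e e').
have /card_gt0P[e0 _] : 0 < #|F| by rewrite F1.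
have kP (g : G) : rng e0 == src g by apply/eqP/T_eq.
exists (fun p => (val p).2); split=> //.
- exists (fun g => exist _ (e0, g) (kP g)) => [[[e g] eg]|//].
  by apply: val_inj; rewrite /= (F_eq e e0).
- by move=> p q; rewrite /= ocomp_leE (F_eq (val p).1 (val q).1) ole_refl;
    case: eqVneq => // ->; rewrite ole_refl.
Qed.

(** The edge set of a premorphism at level 0 is a singleton.  The level [a] is
only propositionally equal to 0, whence the separate variable. *)
Lemma oiso_over_pedg0 (B C : obd) (f : opremor B C) a m (w : vtx C a) :
  a = 0 ->
  oiso_over (fun _ => w) id (pedg f a \oc epath C (lev f a) m) (epath C a m).
Proof.
move=> a0; subst a; move: (pedg0 f) (@pedg_rng _ _ f 0) (lev0 f).
move: (lev f 0) (pedg f 0) => l F F1 Fr l0; subst l.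
exact: oiso_over_single.
Qed.

(** Diagrams with isomorphic telescopings are equivalent. *)
Lemma hps_telescope_iso (B C : obd) (n m : nat -> nat) (n0 : n 0 = 0)
    (n_lt : forall k, n k < n k.+1) (m0 : m 0 = 0)
    (m_lt : forall k, m k < m k.+1)
    (phi : forall k, vtx B (n k) -> vtx C (m k)) :
  (forall k, bijective (phi k)) ->
  (forall k, oiso_over (phi k) (phi k.+1)
     (epath B (n k) (n k.+1)) (epath C (m k) (m k.+1))) ->
  hps_equiv B C.
Proof.
move=> phi_bij over.
apply: (@rst_trans _ _ _ (telescope B n0 n_lt)).
  exact/rst_step/hps_telescope.
apply: (@rst_trans _ _ _ (telescope C m0 m_lt)); last first.
  exact/rst_sym/rst_step/hps_telescope.
by apply/rst_step/hps_iso/(@obd_iso_of_over (telescope B n0 n_lt)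
  (telescope C m0 m_lt) phi).
Qed.

(** Two diagrams and the premorphisms between them are indexed by [bool], so that
one argument treats both sides; level [k] of the interleaving belongs to the
side [odd k]. *)
Section Interleaving.
Variables (X : bool -> obd) (h : forall b, opremor (X b) (X (~~ b))).
Variable c : nat -> nat.
Hypotheses (c0 : c 0 = 0) (c_lt : forall k, c k < c k.+1).
Hypothesis c_lev : forall b k, lev (h b) (c k) <= c k.+1.

Definition ilv_vtx k : finType := vtx (X (odd k)) (c k).

(** From level [c k] of side [b] to level [c k.+1] of the other side. *)
Definition step_edg b k : oedges (vtx (X b) (c k)) (vtx (X (~~ b)) (c k.+1)) :=
  pedg (h b) (c k) \oc epath (X (~~ b)) (lev (h b) (c k)) (c k.+1).

Definition ilv_edg k : oedges (ilv_vtx k) (ilv_vtx k.+1) := step_edg (odd k) k.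

Lemma ilv_vtx_gt0 k : 0 < #|ilv_vtx k|.
Proof. exact: vtx_gt0. Qed.

Lemma ilv_vtx0 : #|ilv_vtx 0| = 1.
Proof. by rewrite /ilv_vtx c0 vtx0. Qed.

Lemma ilv_src k (v : ilv_vtx k) : exists e : ilv_edg k, src e = v.
Proof.
apply: ocomp_src_surj v; first exact: pedg_src.
exact: (opath_src (@edg_src _) (c_lev _ k)).
Qed.

Lemma ilv_rng k (v : ilv_vtx k.+1) : exists e : ilv_edg k, rng e = v.
Proof.
apply: ocomp_rng_surj v; first exact: pedg_rng.
exact: (opath_rng (@edg_rng _) (c_lev _ k)).
Qed.

Lemma ilv_edg_gt0 k : 0 < #|ilv_edg k|.
Proof. exact: src_surj_gt0 (ilv_vtx_gt0 k) (@ilv_src k). Qed.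

(** The interleaving of the two diagrams along the levels [c k]. *)
Definition interleave : obd :=
  @OBDiagram ilv_vtx ilv_edg ilv_vtx_gt0 ilv_vtx0 ilv_edg_gt0 ilv_src ilv_rng.

(** The identity of a vertex set, for two expressions [b], [b'] of the side. *)
Definition side_cast b b' (e : b = b') n : vtx (X b) n -> vtx (X b') n :=
  fun v => ecast x (vtx (X x) n) e v.

Lemma side_cast_bij b b' (e : b = b') n : bijective (@side_cast b b' e n).
Proof. by case: b' / e; exists id. Qed.

(* The two premorphisms are inverse to each other between levels [c k] and
   [c k.+2]; the cast identifies the side [~~ ~~ b] with [b]. *)
Hypothesis h_inv : forall b k,
  oiso (pedg (h b) (c k) \oc pedg (h (~~ b)) (lev (h b) (c k)) \oc
        epath (X (~~ ~~ b)) (lev (h (~~ b)) (lev (h b) (c k))) (c k.+2))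
       (ecast x (oedges (vtx (X b) (c k)) (vtx (X x) (c k.+2)))
          (esym (negbK b)) (epath (X b) (c k) (c k.+2))).

(** Two steps are the paths on one side: the middle path is moved across the
second premorphism, and [h_inv] applies. *)
Lemma step_edg2 b k :
  oiso (step_edg b k \oc step_edg (~~ b) k.+1)
       (ecast x (oedges (vtx (X b) (c k)) (vtx (X x) (c k.+2)))
          (esym (negbK b)) (epath (X b) (c k) (c k.+2))).
Proof.
rewrite -h_inv /step_edg -ocompA.
setoid_rewrite (ocompA (pedg (h b) (c k))).
setoid_rewrite (opremor_comm (h (~~ b)) (c_lev b k)).
setoid_rewrite <- ocompA.
setoid_rewrite ocompA at 1.
rewrite epath_cat //; first reflexivity.
exact: lev_mono.
Qed.

Lemma epath_ilv2 k b (e : odd k = b) (e' : odd k.+2 = b) :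
  oiso_over (@side_cast _ _ e (c k)) (@side_cast _ _ e' (c k.+2))
    (epath interleave k k.+2) (epath (X b) (c k) (c k.+2)).
Proof.
have E : oiso (epath interleave k k.+2) (ilv_edg k \oc ilv_edg k.+1).
  rewrite /epath !opathS // opathkk ocomp1; reflexivity.
apply: (oiso_over_iso (oiso_trans E (step_edg2 (odd k) k)) (oiso_refl _)).
case: b / e e' => e'; have -> : e' = negbK (odd k) by apply: eq_irrelevance.
have castP x (F := epath (X x) (c k) (c k.+2)) :
    oiso_over (@side_cast _ _ (erefl x) (c k))
      (@side_cast _ _ (negbK x) (c k.+2))
      (ecast y (oedges (vtx (X x) (c k)) (vtx (X y) (c k.+2)))
         (esym (negbK x)) F) F.
  rewrite /F {F}; case: x; rewrite /= (eq_irrelevance (negbK _) erefl) /=;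
  exact: oiso_refl.
exact: castP.
Qed.

Lemma interleave_even : hps_equiv interleave (X false).
Proof.
apply: (@hps_telescope_iso interleave (X false) double (fun k => c k.*2) _ _ _ _
  (fun k => @side_cast _ _ (odd_double k) (c k.*2))) => // k.
- by rewrite doubleS; apply: ltn_trans (c_lt _).
- exact: side_cast_bij.
- exact: epath_ilv2.
Qed.

(** A telescoping starts at level 0, which is on the other side; there the vertex
sets are singletons and the first edge set is [step_edg false 0]. *)
Lemma interleave_odd : hps_equiv interleave (X true).
Proof.
pose n k := if k is j.+1 then j.*2.+1 else 0.
have odd_n j : odd (n j.+1) = true by rewrite /n /= odd_double.
have [w0 _] : exists w : vtx (X true) (c 0), true.
  by have /card_gt0P[w _] := vtx_gt0 (X true) (c 0); exists w.
pose phi k : vtx interleave (n k) -> vtx (X true) (c (n k)) :=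
  if k is j.+1 then @side_cast _ _ (odd_n j) (c (n j.+1)) else fun _ => w0.
have w0E w : w = w0.
  have le1 : #|vtx (X true) (c 0)| <= 1 by rewrite c0 vtx0.
  exact: (card_le1_eqP le1).
apply: (@hps_telescope_iso interleave (X true) n (fun k => c (n k))
  _ _ _ _ phi) => //.
- by case.
- by case=> // j; exact: ltn_trans (c_lt _).
- case=> [|j]; last exact: side_cast_bij.
  have /card_gt0P[v0 _] := vtx_gt0 interleave 0.
  exists (fun _ => v0) => [v|w]; last exact/esym/w0E.
  have le1 : #|vtx interleave 0| <= 1 by rewrite vtx0.
  exact: (card_le1_eqP le1).
case=> [|j]; last exact: (@epath_ilv2 (n j.+1) _ (odd_n j) (odd_n j.+1)).
rewrite (_ : phi 1 = id); last first.
  by rewrite /phi /side_cast (eq_irrelevance (odd_n 0) (erefl true)).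
apply: oiso_over_iso (epath1 interleave 0) (oiso_refl _) _.
exact: (oiso_over_pedg0 (h false)).
Qed.

Lemma interleave_hps : hps_equiv (X false) (X true).
Proof.
exact: (rst_trans _ _ _ _ _
  (rst_sym _ _ _ _ interleave_even) interleave_odd).
Qed.

End Interleaving.

Lemma isomorphic_hps_equiv (B C : obd) : obd_isomorphic B C -> hps_equiv B C.
Proof.
case=> f [g [/opremor_equivP[gf _] /opremor_equivP[fg _]]].
pose X b := if b then C else B.
pose h b : opremor (X b) (X (~~ b)) :=
  if b return opremor (X b) (X (~~ b)) then g else f.
have big x : exists y, [/\ x < y, lev f x <= y, lev g x <= y &
    forall m, y <= m -> intertwined (pcomp g f) (pid B) x m /\
                        intertwined (pcomp f g) (pid C) x m].
  have [N1 H1] := gf x; have [N2 H2] := fg x.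
  exists (\max_(i <- [:: x.+1; lev f x; lev g x; N1; N2]) i).
  rewrite !big_cons big_nil; split; try by rewrite !leq_max leqnn ?orbT.
  by move=> m; rewrite !geq_max => /and5P[_ _ _ /H1 ? /andP[/H2 ? _]].
(* As [u x > x], the inequality [u (c k) <= c k.+2] holds, so that the pairs of
   levels needed, [c k] and [c k.+2], are covered. *)
pose u x := sval (constructive_indefinite_description _ (big x)).
have uP x : [/\ x < u x, lev f x <= u x, lev g x <= u x &
    forall m, u x <= m -> intertwined (pcomp g f) (pid B) x m /\
                          intertwined (pcomp f g) (pid C) x m].
  exact: svalP (constructive_indefinite_description _ (big x)).
pose c k := iter k u 0.
have c_lt k : c k < c k.+1 by have [] := uP (c k).
apply: (@interleave_hps X h c erefl c_lt) => [[] k|b k].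
- by have [] := uP (c k).
- by have [] := uP (c k).
have [_ _ _ /(_ _ (ltnW (c_lt k.+1)))[[_ _ gfk] [_ _ fgk]]] := uP (c k).
by case: b; rewrite (eq_irrelevance (esym (negbK _)) erefl) /=;
  apply: oiso_trans (oiso_sym _) (ocomp1r _).
Qed.

Theorem proposition2p9 :
  exists OBD : category omor,
    (forall (B C D : obd) (f : opremor B C) (g : opremor C D),
       cat_comp OBD (omor_of g) (omor_of f) = omor_of (pcomp g f)) /\
    (forall B C : obd, cat_isomorphic OBD B C <-> hps_equiv B C).
Proof.
exists OBD; split=> [B C D f g|B C]; first exact: omor_comp_of.
split=> [/cat_isomorphicE/isomorphic_hps_equiv //|].
exact: hps_equiv_isomorphic.
Qed.
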